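(* Let $u$ and $v$ be unit vectors in $\mathbb{R}^n$, and let $\alpha$ be the angle from $u$ to $v$ with $0\le\alpha<\pi$. For $0\le t\le 1$, let $$u(t)=\frac{\sin((1-t)\alpha)u+\sin(t\alpha)v}{\sin\alpha}$$ if $\alpha>0$; if $\alpha=0$, let $u(t)=u=v$ for all $t$. For $x,y\in\mathbb{R}^n$, the unique geodesic in $\partial F_0$ from $(x-u,x+u)$ to $(y-v,y+v)$ is the curve $$\sigma(t)=((1-t)x+ty-u(t),\ (1-t)x+ty+u(t)).$$ Its length is $$\sqrt{2(\|x-y\|^2+\alpha^2)}.$$
   Context: $F_0(\mathbb{R}^n,2)=\{(x,x')\in\mathbb{R}^n\times\mathbb{R}^n: \|x-x'\|\ge 2\}\subset\mathbb{R}^{2n}$ with the Euclidean metric; it is a manifold with boundary $\partial F_0=\{(x-u,x+u): x,u\in\mathbb{R}^n,\ \|u\|=1\}$. ''Geodesic'' always means minimal geodesic, i.e. a path of minimal (Euclidean) length among all paths in the given space (here $\partial F_0$) with the same endpoints (paths differing by reparametrization being identified). *)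

(* Defs.v *)
From HB Require Import structures.
From mathcomp Require Import all_boot all_order all_algebra.
From mathcomp Require Import all_classical all_reals all_analysis.

Set Implicit Arguments.
Unset Strict Implicit.
Unset Printing Implicit Defensive.

Import Order.TTheory GRing.Theory Num.Theory.
Import numFieldNormedType.Exports.

Local Open Scope classical_set_scope.
Local Open Scope ring_scope.

(* The library norms on 'rV[R]_n and on pairs are sup norms: they are used
   here only for their topology, and the Euclidean metric is defined apart. *)
Section Euclidean.
Context {R : realType} {n : nat}.
Implicit Types (u v : 'rV[R]_n) (p q : 'rV[R]_n * 'rV[R]_n).

Definition dot u v : R := \sum_(i < n) u 0 i * v 0 i.

Definition enorm u : R := Num.sqrt (dot u u).

Definition angle u v : R := acos (dot u v / (enorm u * enorm v)).

(* Euclidean distance of R^(2n) = R^n x R^n *)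
Definition edist p q : R :=
  Num.sqrt (enorm (p.1 - q.1) ^+ 2 + enorm (p.2 - q.2) ^+ 2).

End Euclidean.

(* Boundary of F_0(R^n,2) = {(x, x') | 2 <= |x - x'|}. *)
Definition bdF0 (R : realType) (n : nat) : set ('rV[R]_n * 'rV[R]_n) :=
  [set p | exists x u : 'rV[R]_n, enorm u = 1 /\ p = (x - u, x + u)].

(* Curves are parametrized by [0, 1]; the values of a function R -> _ outside
   [0, 1] are irrelevant in all the definitions below. *)
Section Curves.
Context {R : realType} {n : nat}.
Implicit Types (g h : R -> 'rV[R]_n * 'rV[R]_n).

(* supremum of the lengths of the inscribed polygonal lines *)
Definition curve_length g : \bar R :=
  ereal_sup [set (\sum_(0 <= i < size s)
                    edist (g (nth 1 (0 :: s) i)) (g (nth 1 (0 :: s) i.+1)))%:E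
            | s in [set s : seq R | itv_partition 0 1 s]].

Definition path_in (S : set ('rV[R]_n * 'rV[R]_n))
    (p q : 'rV[R]_n * 'rV[R]_n) g : Prop :=
  [/\ {within `[0, 1], continuous g},
      forall t, t \in `[0, 1] -> S (g t),
      g 0 = p & g 1 = q].

Definition is_geodesic (S : set ('rV[R]_n * 'rV[R]_n))
    (p q : 'rV[R]_n * 'rV[R]_n) g : Prop :=
  path_in S p q g /\
  forall h, path_in S p q h -> (curve_length g <= curve_length h)%E.

Definition param_change (phi : R -> R) : Prop :=
  [/\ {within `[0, 1], continuous phi},
      {in `[0, 1] &, {homo phi : s t / s <= t}},
      phi 0 = 0 & phi 1 = 1].

(* Changes of parameter may be constant on subintervals (a path may pause),
   hence are not invertible; this is why both sides are reparametrized. *)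
Definition same_curve g h : Prop :=
  exists phi psi : R -> R,
    [/\ param_change phi, param_change psi &
        forall t, t \in `[0, 1] -> g (phi t) = h (psi t)].

End Curves.

Section Sigma.
Context {R : realType} {n : nat}.
Implicit Types (u v x y : 'rV[R]_n) (alpha t : R).

Definition arc u v alpha t : 'rV[R]_n :=
  if 0 < alpha then
    (sin alpha)^-1 *: (sin ((1 - t) * alpha) *: u + sin (t * alpha) *: v)
  else u.

Definition sigma x y u v alpha t : 'rV[R]_n * 'rV[R]_n :=
  ((1 - t) *: x + t *: y - arc u v alpha t,
   (1 - t) *: x + t *: y + arc u v alpha t).

End Sigma.

(* Main.v *)
(* Writing (x - u, x + u) as the pair (x, u) identifies bdF0 with R^n x S^(n-1),
   its Euclidean chord distance being sqrt (2 (|dx|^2 + |du|^2)). Replacing the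
   chord |du| by the angle gives a distance d, which satisfies the triangle
   inequality. Chord and angle are equivalent to first order, so refining a
   partition of a continuous path shows that its length is at least the sum of
   the d-distances along any chain of its points. The curve sigma, which is
   d-Lipschitz with constant d(p, q), attains this bound. A path g of length
   d(p, q) gives equality in every triangle p, g t, q; as the angle is less than
   pi, this forces g t = sigma (d(p, g t) / d(p, q)), a monotone change of
   parameter. *)
Require Import Defs.
From HB Require Import structures.
From mathcomp Require Import all_boot all_order all_algebra.
From mathcomp Require Import all_classical all_reals all_analysis.
From mathcomp Require Import ring lra.

Set Implicit Arguments.
Unset Strict Implicit.

Import Order.TTheory GRing.Theory Num.Theory.
Import numFieldNormedType.Exports.

Local Open Scope classical_set_scope.
Local Open Scope ring_scope.

(* The imported libraries shadow these two names of Defs. *)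
Local Notation edist := Defs.edist.
Local Notation arc := Defs.arc.

(** * Euclidean inner product and norm *)

Section EuclideanGeometry.
Context {R : realType} {n : nat}.
Implicit Types (u v w x y z : 'rV[R]_n) (a b : R).

Lemma dotC u v : dot u v = dot v u.
Proof. by apply: eq_bigr => i _; rewrite mulrC. Qed.

Lemma dotDl u v w : dot (u + v) w = dot u w + dot v w.
Proof. by rewrite -big_split; apply: eq_bigr => i _; rewrite mxE mulrDl. Qed.

Lemma dotZl a u v : dot (a *: u) v = a * dot u v.
Proof. by rewrite mulr_sumr; apply: eq_bigr => i _; rewrite mxE mulrA. Qed.

Lemma dotNl u v : dot (- u) v = - dot u v.
Proof. by rewrite -scaleN1r dotZl mulN1r. Qed.

Lemma dotDr u v w : dot w (u + v) = dot w u + dot w v.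
Proof. by rewrite dotC dotDl !(dotC w). Qed.

Lemma dotZr a u v : dot v (a *: u) = a * dot v u.
Proof. by rewrite dotC dotZl dotC. Qed.

Lemma dotNr u v : dot v (- u) = - dot v u.
Proof. by rewrite dotC dotNl dotC. Qed.

Definition dotE := (dotDl, dotDr, dotNl, dotNr, dotZl, dotZr).

Lemma dot_ge0 u : 0 <= dot u u.
Proof. by apply: sumr_ge0 => i _; rewrite -expr2 sqr_ge0. Qed.

Lemma dot_eq0 u : dot u u = 0 -> u = 0.
Proof.
move=> /eqP; rewrite psumr_eq0 => [/allP h|i _]; last by rewrite -expr2 sqr_ge0.
apply/rowP => i; rewrite mxE; apply/eqP.
by have := h i (mem_index_enum _); rewrite mulf_eq0 orbb.
Qed.

Lemma enorm_sqr u : enorm u ^+ 2 = dot u u.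
Proof. by rewrite sqr_sqrtr ?dot_ge0. Qed.

Lemma enorm_ge0 u : 0 <= enorm u.
Proof. exact: sqrtr_ge0. Qed.

Lemma dot_unit u : enorm u = 1 -> dot u u = 1.
Proof. by rewrite -enorm_sqr => ->; rewrite expr1n. Qed.

Lemma enorm_unit u : dot u u = 1 -> enorm u = 1.
Proof. by rewrite /enorm => ->; rewrite sqrtr1. Qed.

Lemma enormBC u v : enorm (u - v) = enorm (v - u).
Proof. by rewrite /enorm -opprB dotNl dotNr opprK. Qed.

(** For nonzero [v], the vector [dot v v *: u - dot u v *: v] is orthogonal to [v], and its squared
    norm is [dot v v] times the difference of the two sides. *)
Lemma cauchy_schwarz u v : dot u v ^+ 2 <= dot u u * dot v v.
Proof.
have [/dot_eq0 ->|v0] := eqVneq (dot v v) 0.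
  by rewrite -(scale0r v) !dotE !mul0r mulr0 expr0n.
have vp : 0 < dot v v by rewrite lt_neqAle eq_sym v0 dot_ge0.
have := dot_ge0 (dot v v *: u - dot u v *: v).
rewrite !dotE (dotC v u) => h.
have {}h : 0 <= dot v v * (dot u u * dot v v - dot u v ^+ 2) by lra.
by rewrite -subr_ge0; rewrite pmulr_rge0 in h.
Qed.

Lemma dot_le_enorm u v : `|dot u v| <= enorm u * enorm v.
Proof.
rewrite -sqrtrM ?dot_ge0// -sqrtr_sqr ler_wsqrtr// cauchy_schwarz//.
Qed.

Lemma enorm_triangle x y z : enorm (x - z) <= enorm (x - y) + enorm (y - z).
Proof.
rewrite -(@ler_pXn2r _ 2)// ?nnegrE ?addr_ge0 ?enorm_ge0//.
rewrite sqrrD !enorm_sqr.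
have := le_trans (ler_norm _) (dot_le_enorm (x - y) (y - z)).
rewrite !dotE (dotC y x) (dotC z x) (dotC z y) => h.
lra.
Qed.

End EuclideanGeometry.

(** * Inequalities between sines, chords and arcs *)

Section Trigonometry.
Context {R : realType}.
Implicit Types (x t : R).

Lemma sin_le x : 0 <= x -> sin x <= x.
Proof.
rewrite le_eqVlt => /predU1P[<-|x0]; first by rewrite sin0.
have [c _] : exists2 c, c \in `]0, x[ & sin x - sin 0 = cos c * (x - 0).
  apply: MVT => //.
  by apply: continuous_subspaceT => ?; exact: continuous_sin.
rewrite sin0 !subr0 => ->.
by rewrite ler_piMl ?cos_le1// ltW.
Qed.

(** The function sin t - t cos t vanishes at 0 and has derivative t sin t, which is nonnegative on
    [0, pi]. *)
Lemma xcos_le_sin x : 0 <= x <= pi -> x * cos x <= sin x.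
Proof.
move=> /andP[]; rewrite le_eqVlt => /predU1P[<-|x0 xpi].
  by rewrite mul0r sin0.
pose f (t : R) := sin t - t * cos t.
have fd t : is_derive t 1 f (t * sin t).
  rewrite /f; apply: is_derive_eq.
  by rewrite !scaler1 /GRing.scale/=; ring.
have [c] : exists2 c, c \in `]0, x[ & f x - f 0 = c * sin c * (x - 0).
  apply: (@MVT _ f (fun t => t * sin t)) => //.
  apply: continuous_subspaceT => t; apply: differentiable_continuous.
  by apply/derivable1_diffP; case: (fd t).
rewrite in_itv/= => /andP[c0 cx]; rewrite /f mul0r sin0 !subr0 => h.
rewrite -subr_ge0 h !mulr_ge0 ?ltW// sin_gt0_pi// c0.
exact: lt_le_trans xpi.
Qed.

Lemma sqr_sin x : sin x ^+ 2 = 1 - cos x ^+ 2.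
Proof. by rewrite -(cos2Dsin2 x); ring. Qed.

Lemma cos_half x : cos x = 1 - 2 * sin (x / 2) ^+ 2.
Proof.
rewrite {1}(_ : x = (x / 2) *+ 2); last by rewrite mulr2n; field.
by rewrite cos_mulr2n sqr_sin; ring.
Qed.

(** The left side is the squared chord 4 sin(x/2)^2 of the arc x. Up to |x| = 2 the bound is sin y
    <= y; beyond, the chord is at most the diameter 2. *)
Lemma chord_le_arc x : 2 - 2 * cos x <= x ^+ 2.
Proof.
rewrite -cos_norm -(@real_normK _ x) ?num_real//.
move: (`|x| : R) (normr_ge0 x) => {}x x0.
have y0 : 0 <= x / 2 by lra.
rewrite cos_half; have [x2|x2] := leP x 2.
- have s0 : 0 <= sin (x / 2).
    by apply: sin_ge0_pi; rewrite y0/=; have := @pi_ge2 R; lra.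
  by have := sin_le y0; nra.
- have := sin_geN1 (x / 2); have := sin_le1 (x / 2); nra.
Qed.

End Trigonometry.

(** * The angle as a distance on the unit sphere *)

Section Angles.
Context {R : realType} {n : nat}.
Implicit Types (u v w : 'rV[R]_n).

Section Unit.
Variables (u v : 'rV[R]_n).
Hypotheses (hu : enorm u = 1) (hv : enorm v = 1).

Lemma dot_unit_itv : -1 <= dot u v <= 1.
Proof. by rewrite -ler_norml (le_trans (dot_le_enorm _ _))// hu hv mulr1. Qed.

Lemma angle_unit : angle u v = acos (dot u v).
Proof. by rewrite /angle hu hv mulr1 divr1. Qed.

Lemma cos_angle : cos (angle u v) = dot u v.
Proof. by rewrite angle_unit acosK// in_itv/= dot_unit_itv. Qed.

Lemma angle_ge0 : 0 <= angle u v.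
Proof. by rewrite angle_unit acos_ge0// dot_unit_itv. Qed.

Lemma angle_le_pi : angle u v <= pi.
Proof. by rewrite angle_unit acos_lepi// dot_unit_itv. Qed.

Lemma chord_angle : enorm (u - v) ^+ 2 = 2 - 2 * cos (angle u v).
Proof.
rewrite cos_angle enorm_sqr !dotE (dotC v u) !dot_unit//; ring.
Qed.

(* With theta = 2y the chord is 2 sin y, so this is y cos y <= sin y. *)
Lemma angle_le_chord :
  angle u v ^+ 2 * (1 - enorm (u - v) ^+ 2 / 4) <= enorm (u - v) ^+ 2.
Proof.
rewrite chord_angle cos_half.
have := angle_ge0; have := angle_le_pi; move: (angle u v) => t tpi t0.
have := sqr_sin (t / 2).
have y0 : 0 <= t / 2 <= pi by lra.
have c0 : 0 <= cos (t / 2) by apply: cos_ge0_pihalf; lra.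
have := xcos_le_sin y0.
have := sin_ge0_pi y0.
move: (sin _) (cos _) c0 => s c c0 s0 cs s2.
have -> : (2 - 2 * (1 - 2 * s ^+ 2)) = 4 * s ^+ 2 by ring.
have -> : 1 - 4 * s ^+ 2 / 4 = c ^+ 2 by rewrite s2; field.
have : (t / 2 * c) ^+ 2 <= s ^+ 2 by rewrite ler_sqr ?nnegrE// mulr_ge0//; lra.
rewrite !exprMn; lra.
Qed.

End Unit.

(** The cosine is strictly decreasing on [0, pi]. This turns upper bounds on angles into lower
    bounds on inner products. *)
Lemma cos_le_angle u v t : enorm u = 1 -> enorm v = 1 -> 0 <= t <= pi ->
  cos t <= dot u v -> angle u v <= t.
Proof.
move=> hu hv tpi; apply: contraTT; rewrite -!ltNge => h.
rewrite -cos_angle// ltr_cos ?in_itv//=.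
by rewrite angle_ge0//= angle_le_pi.
Qed.

(** With a, b the two angles on the right and a + b < pi, the claim is cos(a + b) <= [dot u w]. The
    components of [u] and [w] orthogonal to [v] have norms sin a and sin b and inner product
    [dot u w] - cos a cos b, which Cauchy-Schwarz bounds below by - sin a sin b. *)
Lemma angle_triangle u v w : enorm u = 1 -> enorm v = 1 -> enorm w = 1 ->
  angle u w <= angle u v + angle v w.
Proof.
move=> hu hv hw.
have [h|h] := leP pi (angle u v + angle v w).
  by rewrite (le_trans _ h)// angle_le_pi.
apply: cos_le_angle => //; first by rewrite addr_ge0 ?angle_ge0// ltW.
have su : 0 <= sin (angle u v) by rewrite sin_ge0_pi// angle_ge0//= angle_le_pi.
have sv : 0 <= sin (angle v w) by rewrite sin_ge0_pi// angle_ge0//= angle_le_pi.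
have su2 := sqr_sin (angle u v); have sv2 := sqr_sin (angle v w).
rewrite cosD; rewrite !cos_angle// in su2 sv2 *.
have := cauchy_schwarz (u - dot u v *: v) (w - dot v w *: v).
rewrite !dotE (dotC v u) (dotC w v) !dot_unit// => cs.
have {}cs : (dot u w - dot u v * dot v w) ^+ 2 <=
   (sin (angle u v) * sin (angle v w)) ^+ 2.
  by rewrite exprMn su2 sv2; lra.
have := mulr_ge0 su sv; nra.
Qed.

(* Equality case of the triangle inequality: the Gram determinant of u, v, w
   vanishes, and the vector below has squared norm 0. *)
Lemma angle_add_collinear u v w a b :
  dot u u = 1 -> dot v v = 1 -> dot w w = 1 ->
  dot u v = cos a -> dot v w = cos b -> dot u w = cos (a + b) ->
  sin (a + b) *: v = sin b *: u + sin a *: w.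
Proof.
move=> uu vv ww uv vw uw; apply/subr0_eq/dot_eq0.
rewrite !dotE (dotC v u) (dotC w u) (dotC w v) uu vv ww uv vw uw sinD cosD.
have := sqr_sin a; have := sqr_sin b.
move: (sin a) (sin b) (cos a) (cos b) => sa sb ca cb hb ha.
transitivity (sa ^+ 2 * (1 - cb ^+ 2) + sb ^+ 2 * (1 - ca ^+ 2)
   - 2 * sa ^+ 2 * sb ^+ 2); first ring.
by rewrite -ha -hb; ring.
Qed.

End Angles.

(** * The boundary as a product of R^n and the sphere: chordal and intrinsic distances *)

Section ProductMetric.
Context {R : realType} {n : nat}.
Implicit Types (p q m : 'rV[R]_n * 'rV[R]_n).

(** Together with [direction], this inverts the map (x, u) |-> (x - u, x + u). *)
Definition center p : 'rV[R]_n := 2^-1 *: (p.1 + p.2).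

Definition direction p : 'rV[R]_n := 2^-1 *: (p.2 - p.1).

(* The intrinsic distance of [bdF0], which is R^n x S^(n-1) with its product
   metric scaled by sqrt 2. *)
Definition bdist p q : R :=
  Num.sqrt (2 * (enorm (center p - center q) ^+ 2 +
                 angle (direction p) (direction q) ^+ 2)).

Lemma center_direction p : p = (center p - direction p, center p + direction p).
Proof.
case: p => p1 p2; rewrite /center /direction/=.
by congr (_, _); apply/rowP => i; rewrite !mxE; field.
Qed.

Lemma center_pair (x u : 'rV[R]_n) : center (x - u, x + u) = x.
Proof. by apply/rowP => i; rewrite !mxE/=; field. Qed.

Lemma direction_pair (x u : 'rV[R]_n) : direction (x - u, x + u) = u.
Proof. by apply/rowP => i; rewrite !mxE/=; field. Qed.

Lemma bdF0_direction p : @bdF0 R n p -> enorm (direction p) = 1.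
Proof. by case=> x [u [hu ->]]; rewrite direction_pair. Qed.

(** This is the parallelogram law for the differences of centers and of directions. *)
Lemma edistE p q : edist p q =
  Num.sqrt (2 * (enorm (center p - center q) ^+ 2 +
                 enorm (direction p - direction q) ^+ 2)).
Proof.
rewrite [in LHS](center_direction p) [in LHS](center_direction q) /edist/=.
congr Num.sqrt; rewrite !enorm_sqr.
have -> : center p - direction p - (center q - direction q) =
  (center p - center q) - (direction p - direction q).
  by rewrite !opprD !opprK addrACA.
have -> : center p + direction p - (center q + direction q) =
  (center p - center q) + (direction p - direction q) by rewrite opprD addrACA.
move: (center p - center q) (direction p - direction q) => a b.
by rewrite !dotE (dotC b a); ring.
Qed.

Lemma edist_ge0 p q : 0 <= edist p q.
Proof. exact: sqrtr_ge0. Qed.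

Lemma edist_sqr p q : edist p q ^+ 2 =
  2 * (enorm (center p - center q) ^+ 2 +
       enorm (direction p - direction q) ^+ 2).
Proof. by rewrite edistE sqr_sqrtr// mulr_ge0// addr_ge0// sqr_ge0. Qed.

Lemma bdist_ge0 p q : 0 <= bdist p q.
Proof. exact: sqrtr_ge0. Qed.

Lemma bdist_sqr p q : bdist p q ^+ 2 =
  2 * (enorm (center p - center q) ^+ 2 +
       angle (direction p) (direction q) ^+ 2).
Proof. by rewrite sqr_sqrtr// mulr_ge0// addr_ge0// sqr_ge0. Qed.

Lemma bdistxx p : bdF0 p -> bdist p p = 0.
Proof.
move=> /bdF0_direction hp.
rewrite /bdist angle_unit// dot_unit// acos1 subrr /enorm.
by rewrite -(scale0r 0) !dotE !mul0r sqrtr0 expr0n/= addr0 mulr0 sqrtr0.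
Qed.

Lemma bdist_eq0 p q : bdF0 p -> bdF0 q -> bdist p q = 0 -> p = q.
Proof.
move=> /bdF0_direction hp /bdF0_direction hq pq.
have := bdist_sqr p q; rewrite pq expr0n/= => h.
have h1 := sqr_ge0 (enorm (center p - center q)).
have h2 := sqr_ge0 (angle (direction p) (direction q)).
have c0 : enorm (center p - center q) ^+ 2 = 0 by lra.
have /eqP : angle (direction p) (direction q) ^+ 2 = 0 by lra.
rewrite sqrf_eq0 => /eqP a0.
have := chord_angle hp hq; rewrite a0 cos0 mulr1 subrr !enorm_sqr in c0 *.
move=> d0; rewrite (center_direction p) (center_direction q).
by rewrite (subr0_eq (dot_eq0 c0)) (subr0_eq (dot_eq0 d0)).
Qed.

(** First-order equivalence of chord and arc: the assumption bounds the squared chord of the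
    directions by 4e, so the factor 1 - chord^2 / 4 in [angle_le_chord] is at least 1 - e. For e <
    1, (1 - e)^2 <= 1 - e then gives the squared claim. *)
Lemma bdist_le_edist p q e : bdF0 p -> bdF0 q -> 0 <= e ->
  edist p q ^+ 2 <= 8 * e -> (1 - e) * bdist p q <= edist p q.
Proof.
move=> /bdF0_direction hp /bdF0_direction hq e0 pqe.
have [e1|e1] := leP 1 e.
  by rewrite (le_trans _ (edist_ge0 _ _))// mulr_le0_ge0 ?bdist_ge0// subr_le0.
have e1' : 0 <= 1 - e by rewrite subr_ge0 ltW.
rewrite -ler_sqr ?nnegrE ?mulr_ge0 ?bdist_ge0 ?edist_ge0//.
rewrite exprMn edist_sqr bdist_sqr in pqe *.
have := angle_le_chord hp hq.
have := sqr_ge0 (enorm (center p - center q)).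
have := sqr_ge0 (angle (direction p) (direction q)).
move: pqe; move: (enorm (center p - _) ^+ 2) (angle _ _ ^+ 2).
move: (enorm (direction p - _) ^+ 2).
move=> d a t pqe t0 a0 h.
have td : t * (1 - e) <= d by apply: le_trans h; rewrite ler_wpM2l//; lra.
have e2 : (1 - e) ^+ 2 <= 1 - e by rewrite expr2 ler_piMl//; lra.
have := ler_wpM2r a0 e2; have := ler_wpM2r t0 e2; have := mulr_ge0 e0 a0.
lra.
Qed.

End ProductMetric.

(** * The triangle inequality in the plane and its equality case *)

Section Minkowski.
Context {R : realType}.
Implicit Types a b c d e : R.

(** Minkowski's inequality for (a1, b1) and (a2, b2), by way of Cauchy-Schwarz; the defect in the
    latter is the square of a1 b2 - a2 b1. Inequalities for [a] and [b] suffice, so two triangle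
    inequalities can be combined. *)
Lemma sqrt_triangle a1 a2 b1 b2 a b :
  0 <= a -> 0 <= b -> a <= a1 + a2 -> b <= b1 + b2 ->
  Num.sqrt (2 * (a ^+ 2 + b ^+ 2)) <=
  Num.sqrt (2 * (a1 ^+ 2 + b1 ^+ 2)) + Num.sqrt (2 * (a2 ^+ 2 + b2 ^+ 2)).
Proof.
move=> a0 b0 ha hb.
have pos x y : 0 <= 2 * (x ^+ 2 + y ^+ 2) :> R.
  by rewrite mulr_ge0// addr_ge0 ?sqr_ge0.
rewrite -(@ler_pXn2r _ 2)// ?nnegrE ?addr_ge0 ?sqrtr_ge0//.
rewrite sqrrD !sqr_sqrtr//.
have : 2 * (a1 * a2 + b1 * b2) <=
    Num.sqrt (2 * (a1 ^+ 2 + b1 ^+ 2)) * Num.sqrt (2 * (a2 ^+ 2 + b2 ^+ 2)).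
  rewrite -sqrtrM//; apply: le_trans (ler_norm _) _.
  rewrite -sqrtr_sqr ler_wsqrtr//.
  by have := sqr_ge0 (a1 * b2 - a2 * b1); nra.
have : a ^+ 2 <= (a1 + a2) ^+ 2 by rewrite ler_sqr// nnegrE// (le_trans a0).
have : b ^+ 2 <= (b1 + b2) ^+ 2 by rewrite ler_sqr// nnegrE// (le_trans b0).
nra.
Qed.

(** Equality overall forces equality in each coordinate and in Cauchy-Schwarz. Hence (a1, b1) is the
    multiple of (a, b) by d1 / (d1 + d2), stated here without division. *)
Lemma sqrt_triangle_eq a1 a2 b1 b2 a b d1 d2 :
  0 <= a -> 0 <= b -> a <= a1 + a2 -> b <= b1 + b2 ->
  0 <= a1 -> 0 <= a2 -> 0 <= b1 -> 0 <= b2 -> 0 <= d1 -> 0 <= d2 ->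
  0 < d1 + d2 ->
  d1 ^+ 2 = 2 * (a1 ^+ 2 + b1 ^+ 2) -> d2 ^+ 2 = 2 * (a2 ^+ 2 + b2 ^+ 2) ->
  (d1 + d2) ^+ 2 = 2 * (a ^+ 2 + b ^+ 2) ->
  [/\ a1 + a2 = a, b1 + b2 = b, a1 * (d1 + d2) = a * d1
    & b1 * (d1 + d2) = b * d1].
Proof.
move=> a0 b0 ha hb a10 a20 b10 b20 d10 d20 d0 e1 e2 e.
have : 2 * (a1 * a2 + b1 * b2) <= d1 * d2.
  rewrite -(@ler_pXn2r _ 2)// ?nnegrE ?mulr_ge0 ?addr_ge0 ?mulr_ge0//.
  by rewrite !exprMn e1 e2; have := sqr_ge0 (a1 * b2 - a2 * b1); nra.
move=> h.
have ha2 : a ^+ 2 <= (a1 + a2) ^+ 2 by rewrite ler_sqr// nnegrE addr_ge0.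
have hb2 : b ^+ 2 <= (b1 + b2) ^+ 2 by rewrite ler_sqr// nnegrE addr_ge0.
have h' : d1 * d2 = 2 * (a1 * a2 + b1 * b2) by nra.
have ea : (a1 + a2) ^+ 2 = a ^+ 2 by nra.
have eb : (b1 + b2) ^+ 2 = b ^+ 2 by nra.
have {}ea : a1 + a2 = a.
  by apply/eqP; rewrite -(@eqrXn2 _ 2) ?addr_ge0// ea.
have {}eb : b1 + b2 = b.
  by apply/eqP; rewrite -(@eqrXn2 _ 2) ?addr_ge0// eb.
(* The squared distance between (d1 + d2)(a1, b1) and d1 (a, b). *)
have z : (a1 * (d1 + d2) - a * d1) ^+ 2 + (b1 * (d1 + d2) - b * d1) ^+ 2 = 0.
  transitivity ((a1 ^+ 2 + b1 ^+ 2) * (d1 + d2) ^+ 2 + (a ^+ 2 + b ^+ 2) * d1 ^+ 2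
    - (d1 + d2) * d1 * (2 * (a1 * a + b1 * b))); first ring.
  have -> : 2 * (a1 * a + b1 * b) = d1 ^+ 2 + d1 * d2.
    by rewrite -ea -eb e1 h'; ring.
  have -> : a ^+ 2 + b ^+ 2 = (d1 + d2) ^+ 2 / 2 by rewrite e; field.
  have -> : a1 ^+ 2 + b1 ^+ 2 = d1 ^+ 2 / 2 by rewrite e1; field.
  by field.
move/eqP: z; rewrite paddr_eq0 ?sqr_ge0// !sqrf_eq0 !subr_eq0.
by case/andP => /eqP ? /eqP ?.
Qed.

End Minkowski.

(** * Triangles in the intrinsic metric and their equality case *)

Section BoundaryMetric.
Context {R : realType} {n : nat}.
Implicit Types (p q m : 'rV[R]_n * 'rV[R]_n) (u v x y z : 'rV[R]_n) (s t : R).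

Lemma bdist_triangle p m q : bdF0 p -> bdF0 m -> bdF0 q ->
  bdist p q <= bdist p m + bdist m q.
Proof.
move=> /bdF0_direction hp /bdF0_direction hm /bdF0_direction hq.
apply: sqrt_triangle; rewrite ?enorm_ge0 ?angle_ge0 ?angle_triangle//.
exact: enorm_triangle.
Qed.

(** Put P = x - z and Q = z - y. Expanding |P + Q|^2 determines the inner product of P and Q, and
    then (1 - s) P - s Q has squared norm 0. *)
Lemma segment_eq x y z s : enorm (x - z) = s * enorm (x - y) ->
  enorm (z - y) = (1 - s) * enorm (x - y) -> z = (1 - s) *: x + s *: y.
Proof.
move=> /(congr1 (fun r => r ^+ 2)) xz /(congr1 (fun r => r ^+ 2)) zy.
have xy : enorm (x - y) ^+ 2 = dot (x - z + (z - y)) (x - z + (z - y)).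
  by rewrite subrKA enorm_sqr.
have zE : (1 - s) *: x + s *: y - z = (1 - s) *: (x - z) - s *: (z - y).
  by apply/rowP => i; rewrite !mxE; ring.
apply/esym/subr0_eq/dot_eq0; rewrite zE.
move: xy xz zy; rewrite !exprMn !(enorm_sqr (_ - z)) !(enorm_sqr (z - _)).
move: (enorm _ ^+ 2) (x - z) (z - y) => A P Q.
rewrite !dotE (dotC Q P).
move: (dot P P) (dot P Q) (dot Q Q) => a b c Ae ae ce; rewrite ae ce in Ae *.
have {}Ae : 2 * b = 2 * s * (1 - s) * A by lra.
transitivity (2 * s ^+ 2 * (1 - s) ^+ 2 * A - s * (1 - s) * (2 * b)); first ring.
by rewrite Ae; ring.
Qed.

(** The spherical counterpart of [segment_eq]: [angle_add_collinear] for the angles s alpha and (1 -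
    s) alpha, divided by sin alpha, which is nonzero for 0 < alpha < pi. If alpha = 0, then [w] =
    [u]. *)
Lemma arc_eq u v w s : enorm u = 1 -> enorm v = 1 -> enorm w = 1 ->
  angle u v < pi -> angle u w = s * angle u v ->
  angle w v = (1 - s) * angle u v -> w = arc u v (angle u v) s.
Proof.
move=> hu hv hw api uw wv; rewrite /arc; case: ifPn => [a0|].
  have sa : sin (angle u v) != 0 by rewrite gt_eqF// sin_gt0_pi// a0.
  apply: (scalerI sa); rewrite scalerA divff// scale1r.
  have aE : angle u v = s * angle u v + (1 - s) * angle u v by ring.
  rewrite [X in sin X *: w]aE.
  apply: angle_add_collinear; rewrite ?dot_unit//.
  - by rewrite -uw cos_angle.
  - by rewrite -wv cos_angle.
  - by rewrite -aE cos_angle.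
rewrite -leNgt => a0; have {}a0 : angle u v = 0.
  by apply/le_anti; rewrite a0 angle_ge0.
move: uw; rewrite a0 mulr0 => uw.
have := chord_angle hu hw; rewrite uw cos0 mulr1 subrr enorm_sqr.
by move/dot_eq0/subr0_eq.
Qed.

(** Equality in the product metric passes to both factors, which are divided in the same ratio;
    [segment_eq] and [arc_eq] then locate the center and the direction of [m]. *)
Lemma bdist_triangle_eq p m q : bdF0 p -> bdF0 m -> bdF0 q ->
  0 < bdist p q -> bdist p m + bdist m q <= bdist p q ->
  angle (direction p) (direction q) < pi ->
  m = sigma (center p) (center q) (direction p) (direction q)
        (angle (direction p) (direction q)) (bdist p m / bdist p q).
Proof.
move=> hp hm hq d0 dle api.
have dE : bdist p m + bdist m q = bdist p q.
  by apply/le_anti; rewrite dle bdist_triangle.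
have := bdF0_direction hp; have := bdF0_direction hm; have := bdF0_direction hq.
move=> uq um up.
have [] := @sqrt_triangle_eq R
  (enorm (center p - center m)) (enorm (center m - center q))
  (angle (direction p) (direction m)) (angle (direction m) (direction q))
  (enorm (center p - center q)) (angle (direction p) (direction q))
  (bdist p m) (bdist m q); rewrite ?enorm_ge0 ?angle_ge0 ?bdist_ge0 ?bdist_sqr
  ?angle_triangle ?enorm_triangle ?dE ?bdist_sqr//.
move=> cE aE cl al.
have d1 : bdist p q != 0 by rewrite gt_eqF.
set s := bdist p m / bdist p q.
have {}cl : enorm (center p - center m) = s * enorm (center p - center q).
  by rewrite -[LHS](mulfK d1) cl /s; ring.
have {}al : angle (direction p) (direction m) =
    s * angle (direction p) (direction q).
  by rewrite -[LHS](mulfK d1) al /s; ring.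
rewrite [LHS](center_direction m) /sigma.
rewrite -(@segment_eq (center p) (center q) (center m) s)//; last first.
  by rewrite mulrBl -cl -cE mul1r [RHS]addrC addKr.
rewrite -(@arc_eq (direction p) (direction q) (direction m) s)//.
by rewrite mulrBl -al -aE mul1r [RHS]addrC addKr.
Qed.

(** * The curve [sigma]: endpoints, speed and continuity *)

Section Sigma.
Variables (u v x y : 'rV[R]_n) (alpha : R).
Hypotheses (hu : enorm u = 1) (hv : enorm v = 1) (uv : dot u v = cos alpha).
Hypothesis halpha : 0 <= alpha < pi.

(** The arc turns at constant angular speed alpha; s = t shows that it stays on the unit sphere. *)
Lemma dot_arc s t :
  dot (arc u v alpha s) (arc u v alpha t) = cos ((s - t) * alpha).
Proof.
have /andP[a0 api] := halpha; rewrite /arc; case: ifPn => [{}a0|]; last first.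
  rewrite -leNgt => a0'; have -> : alpha = 0 by apply/le_anti; rewrite a0' a0.
  by rewrite mulr0 cos0 dot_unit.
have sa : sin alpha != 0 by rewrite gt_eqF// sin_gt0_pi// a0.
rewrite !dotE (dotC v u) !dot_unit// uv !mulrBl !mul1r !sinB !cosB.
have := sqr_sin alpha.
move: (sin alpha) (cos alpha) sa => S C S0 SC.
move: (sin (s * _)) (cos (s * _)) (sin (t * _)) (cos (t * _)) => a' a b' b.
(* Once the denominator is cleared, replacing S^2 by 1 - C^2 in the sine term alone leaves a
   polynomial identity. *)
apply: (mulfI (expf_neq0 2 S0)); rewrite [RHS](_ : _ =
  S ^+ 2 * a * b + a' * b' * (S ^+ 2)); last ring.
rewrite [X in _ = _ + _ * X]SC; field.
exact: S0.
Qed.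

Lemma enorm_arc t : enorm (arc u v alpha t) = 1.
Proof. by apply: enorm_unit; rewrite dot_arc subrr mul0r cos0. Qed.

Lemma sigma_bdF0 t : bdF0 (sigma x y u v alpha t).
Proof. by do 2 eexists; split; [exact: (enorm_arc t)|]. Qed.

Lemma arc0 : arc u v alpha 0 = u.
Proof.
rewrite /arc; case: ifPn => // a0; have /andP[_ api] := halpha.
have sa : sin alpha != 0 by rewrite gt_eqF// sin_gt0_pi// a0.
by rewrite subr0 mul1r mul0r sin0 scale0r addr0 scalerA mulVf// scale1r.
Qed.

Lemma arc1 : arc u v alpha 1 = v.
Proof.
have /andP[a0 api] := halpha; rewrite /arc; case: ifPn => [{}a0|].
  have sa : sin alpha != 0 by rewrite gt_eqF// sin_gt0_pi// a0.
  by rewrite subrr mul1r mul0r sin0 scale0r add0r scalerA mulVf// scale1r.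
rewrite -leNgt => a0'; have a00 : alpha = 0 by apply/le_anti; rewrite a0' a0.
apply/subr0_eq/dot_eq0; rewrite !dotE (dotC v u) uv a00 cos0 !dot_unit//; ring.
Qed.

Lemma sigma0 : sigma x y u v alpha 0 = (x - u, x + u).
Proof. by rewrite /sigma arc0 subr0 scale1r scale0r addr0. Qed.

Lemma sigma1 : sigma x y u v alpha 1 = (y - v, y + v).
Proof. by rewrite /sigma arc1 subrr scale1r scale0r add0r. Qed.

(** The centers move along a line at constant speed, and the chord between two directions is at most
    the arc |s - t| alpha. *)
Lemma edist_sigma s t : s <= t ->
  edist (sigma x y u v alpha s) (sigma x y u v alpha t) <=
  (t - s) * Num.sqrt (2 * (enorm (x - y) ^+ 2 + alpha ^+ 2)).
Proof.
move=> st; have ts : 0 <= t - s by rewrite subr_ge0.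
rewrite -[X in X * _](@ger0_norm _ (t - s))// -sqrtr_sqr -sqrtrM ?sqr_ge0//.
rewrite edistE; apply: ler_wsqrtr; rewrite !center_pair !direction_pair.
have -> : (1 - s) *: x + s *: y - ((1 - t) *: x + t *: y) = (t - s) *: (x - y).
  by apply/rowP => i; rewrite !mxE; ring.
move: (x - y) => d; rewrite !enorm_sqr !dotE !dot_arc !subrr !mul0r cos0.
have -> : cos ((t - s) * alpha) = cos ((s - t) * alpha).
  by rewrite -cosN; congr cos; ring.
by have := chord_le_arc ((s - t) * alpha); lra.
Qed.

Lemma continuous_arc : continuous (arc u v alpha).
Proof.
move=> t; rewrite /arc; case: (0 < alpha); last exact: cvg_cst.
apply: cvgZl_tmp; apply: cvgD; apply: cvgZr_tmp.
- apply: (@continuous_comp _ _ _ (fun t : R => (1 - t) * alpha) sin);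
    last exact: continuous_sin.
  by apply: cvgM; [apply: cvgB; [exact: cvg_cst|exact: cvg_id]|exact: cvg_cst].
- apply: (@continuous_comp _ _ _ (fun t : R => t * alpha) sin);
    last exact: continuous_sin.
  by apply: cvgM; [exact: cvg_id|exact: cvg_cst].
Qed.

Lemma continuous_sigma : continuous (sigma x y u v alpha).
Proof.
move=> t.
have c : (1 - s) *: x + s *: y @[s --> t] --> (1 - t) *: x + t *: y.
  apply: cvgD; apply: cvgZr_tmp; last exact: cvg_id.
  by apply: cvgB; [exact: cvg_cst|exact: cvg_id].
have a : arc u v alpha s @[s --> t] --> arc u v alpha t.
  exact: continuous_arc.
apply: (@cvg_pair _ _ _ (nbhs t)
  (nbhs ((1 - t) *: x + t *: y - arc u v alpha t))
  (nbhs ((1 - t) *: x + t *: y + arc u v alpha t))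
  _ _ _ (fun t => (1 - t) *: x + t *: y - arc u v alpha t)
  (fun t => (1 - t) *: x + t *: y + arc u v alpha t)).
  exact: cvgB c a.
exact: cvgD c a.
Qed.

End Sigma.

End BoundaryMetric.

(** * Real induction and inscribed polygons *)

Section Lengths.
Context {R : realType} {n : nat}.
Implicit Types (p q m : 'rV[R]_n * 'rV[R]_n) (s t e : R) (l : seq R).
Implicit Types (g : R -> 'rV[R]_n * 'rV[R]_n).

(* Real induction: the supremum of the points that P links to a is b. *)
Lemma interval_induction (P : R -> R -> Prop) (a b : R) : a <= b ->
  (forall s t r, a <= s -> s <= t -> t <= r -> r <= b ->
    P s t -> P t r -> P s r) ->
  (forall t, a <= t <= b -> exists2 d, 0 < d &
    forall s, a <= s <= b -> `|t - s| < d ->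
      (s <= t -> P s t) /\ (t <= s -> P t s)) ->
  P a b.
Proof.
move=> ab trans loc.
pose T := [set t | a <= t <= b /\ P a t].
have aT : T a.
  split; first by rewrite lexx ab.
  have [|d d0 /(_ a)] := loc a; first by rewrite lexx ab.
  by rewrite lexx ab subrr normr0 => /(_ isT d0)[h _]; exact: h.
have ubT : ubound T b by move=> t [/andP[]].
have supT : has_sup T by split; [exists a|exists b].
have ac : a <= sup T by apply: ub_le_sup => //; exists b.
have cb : sup T <= b by apply: ge_sup => //; exists a.
have [|d d0 hd] := loc (sup T); first by rewrite ac cb.
have [t [/andP[at_ tb] Pat] ct] := sup_adherent d0 supT.
have tc : t <= sup T.
  by apply: ub_le_sup; [exists b|split => //; rewrite at_ tb].
have Pac : P a (sup T).
  apply: (trans a t) => //; have [||h _] := hd t.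
  - by rewrite at_ tb.
  - by rewrite ger0_norm ?subr_ge0//; lra.
  - exact: h.
(* A point past the supremum but still within [d] of it, cut off at [b]; it lies in T, so the
   supremum can only be [b]. *)
pose r := Num.min b (sup T + d / 2).
have cr : sup T <= r by rewrite le_min cb/= lerDl; lra.
have rb : r <= b by rewrite ge_min lexx.
have Par : P a r.
  apply: (trans a (sup T)) => //; have [||_ h] := hd r; last exact: h.
    by rewrite (le_trans ac cr) rb.
  rewrite distrC ger0_norm ?subr_ge0//.
  suff : r <= sup T + d / 2 by lra.
  by rewrite ge_min lexx orbT.
have rc : r <= sup T.
  by apply: ub_le_sup; [exists b|split => //; rewrite (le_trans ac cr) rb].
suff <- : r = b by [].
apply/le_anti; rewrite rb/= leNgt; apply/negP => rltb.
have : r = sup T + d / 2 by move: rltb; rewrite /r minEle; case: ifPn; lra.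
lra.
Qed.

(** The inscribed sum of [curve_length] in recursive form, suited to induction and concatenation. *)
Fixpoint polygon_length g (a : R) l : R :=
  if l is b :: l' then edist (g a) (g b) + polygon_length g b l' else 0.

Lemma polygon_lengthE g a l : \sum_(0 <= i < size l)
    edist (g (nth 1 (a :: l) i)) (g (nth 1 (a :: l) i.+1)) =
  polygon_length g a l.
Proof.
elim: l a => [|b l ih] a; first by rewrite big_nil.
by rewrite big_nat_recl//= ih.
Qed.

Lemma polygon_length_cat g a l1 l2 : polygon_length g a (l1 ++ l2) =
  polygon_length g a l1 + polygon_length g (last a l1) l2.
Proof. by elim: l1 a => [|b l ih] a /=; rewrite ?add0r// ih addrA. Qed.

Lemma polygon_length_le g (L a b : R) l :
  (forall s t, s <= t -> edist (g s) (g t) <= (t - s) * L) ->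
  itv_partition a b l -> polygon_length g a l <= (b - a) * L.
Proof.
move=> gL; elim: l a => [|c l ih] a /=.
  by move=> /itv_partition_nil ->; rewrite subrr mul0r.
move=> h; have := ih _ (itv_partition_cons h).
case: h => /= /andP[/ltW/gL ac _] _; lra.
Qed.

Lemma polygon_length_le_curve g l : itv_partition 0 1 l ->
  ((polygon_length g 0 l)%:E <= curve_length g)%E.
Proof.
move=> l01; apply: ereal_sup_ubound; exists l => //.
by rewrite polygon_lengthE.
Qed.

(** * Lower bound for the length of a path in the boundary *)

Section Path.
Variable g : R -> 'rV[R]_n * 'rV[R]_n.
Hypothesis gc : {within `[0, 1], continuous g}.
Hypothesis gS : forall t, t \in `[0, 1] -> bdF0 (g t).

Let gS' t : 0 <= t <= 1 -> bdF0 (g t).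
Proof. by move=> t01; apply: gS; rewrite in_itv. Qed.

(** The topology is that of the sup norm, so continuity is read off the coordinates, in which the
    squared norm is polynomial. *)
Lemma continuous_enorm_sqr : continuous (fun v : 'rV[R]_n => enorm v ^+ 2).
Proof.
have -> : (fun v : 'rV[R]_n => enorm v ^+ 2) =
    (fun v => \sum_(i < n) v 0 i * v 0 i).
  by apply/funext => v; rewrite enorm_sqr.
apply: continuous_big => [|i _ v]; first exact: add_continuous.
have c : w 0 i @[w --> v] --> v 0 i by exact: coord_continuous.
exact: (cvgM c c).
Qed.

Lemma continuous_edist_sqr p : continuous (fun q => edist p q ^+ 2).
Proof.
have -> : (fun q => edist p q ^+ 2) =
    (fun q => enorm (p.1 - q.1) ^+ 2 + enorm (p.2 - q.2) ^+ 2).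
  by apply/funext => q; rewrite sqr_sqrtr// addr_ge0 ?sqr_ge0.
move=> q; apply: cvgD.
- apply: (@continuous_comp _ _ _
    (fun q : 'rV[R]_n * 'rV[R]_n => p.1 - q.1)
    (fun v => enorm v ^+ 2)); last exact: continuous_enorm_sqr.
  by apply: cvgB; [exact: cvg_cst|exact: cvg_fst].
- apply: (@continuous_comp _ _ _
    (fun q : 'rV[R]_n * 'rV[R]_n => p.2 - q.2)
    (fun v => enorm v ^+ 2)); last exact: continuous_enorm_sqr.
  by apply: cvgB; [exact: cvg_cst|exact: cvg_snd].
Qed.

Lemma edistxx p : edist p p ^+ 2 = 0.
Proof.
rewrite edist_sqr !subrr enorm_sqr -(scale0r 0) !dotE !mul0r.
by rewrite addr0 mulr0.
Qed.

Lemma edistC p q : edist p q = edist q p.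
Proof. by rewrite /Defs.edist enormBC (enormBC p.2). Qed.

Lemma path_edist_small t e : 0 <= t <= 1 -> 0 < e -> exists2 d, 0 < d &
  forall s, 0 <= s <= 1 -> `|t - s| < d -> edist (g t) (g s) ^+ 2 <= e.
Proof.
move=> t01 e0.
have := (subspace_continuousP _ _).1 gc t; rewrite /= in_itv/= => /(_ t01) gt.
have := cvg_comp _ _ gt (@continuous_edist_sqr (g t) (g t)).
rewrite edistxx => /cvgr_dist_lt /(_ e e0).
rewrite near_withinE => /nbhs_ballP[d /= d0 hd].
exists d => // s s01 ts; have := hd s ts; rewrite in_itv/= => /(_ s01).
by rewrite /= sub0r normrN ger0_norm ?sqr_ge0// => /ltW.
Qed.

(** Close to any point a single segment suffices, by [bdist_le_edist]. Polygons concatenate by the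
    triangle inequality, and since the loss 1 - e is a factor it does not accumulate;
    [interval_induction] does the rest. *)
Lemma path_polygon e s t : 0 < e <= 1 -> 0 <= s -> s <= t -> t <= 1 ->
  exists l, itv_partition s t l /\
    (1 - e) * bdist (g s) (g t) <= polygon_length g s l.
Proof.
move=> /andP[e0 e1] s0 st t1.
have step a b : 0 <= a <= 1 -> 0 <= b <= 1 -> a <= b ->
    edist (g a) (g b) ^+ 2 <= 8 * e -> exists l, itv_partition a b l /\
    (1 - e) * bdist (g a) (g b) <= polygon_length g a l.
  move=> a01 b01; rewrite le_eqVlt => /predU1P[<- _|ab abe].
    (* Partitions increase strictly, so a degenerate interval takes the empty one. *)
    exists [::]; split; first by split.
    by rewrite bdistxx ?mulr0//; exact: gS'.
  exists [:: b]; split; first exact: itv_partition1.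
  by rewrite /= addr0 bdist_le_edist//; [exact: gS'|exact: gS'|exact: ltW].
pose P a b := exists l, itv_partition a b l /\
  (1 - e) * bdist (g a) (g b) <= polygon_length g a l.
apply: (@interval_induction P s t st).
  move=> a b c sa ab bc ct [l1 [p1 h1]] [l2 [p2 h2]].
  exists (l1 ++ l2); split; first exact: itv_partition_cat p1 p2.
  rewrite polygon_length_cat; have [_ /eqP ->] := p1.
  apply: le_trans (lerD h1 h2); rewrite -mulrDr ler_wpM2l ?subr_ge0//.
  have a0 := le_trans s0 sa; have c1 := le_trans ct t1.
  apply: bdist_triangle; apply: gS'; rewrite ?a0 ?c1 ?andbT/=.
  - exact: le_trans (le_trans ab bc) c1.
  - by rewrite (le_trans a0 ab) (le_trans bc c1).
  - exact: le_trans (le_trans a0 ab) bc.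
move=> a /andP[sa at_].
have a01 : 0 <= a <= 1 by apply/andP; split; lra.
have e8 : 0 < 8 * e by lra.
have [d d0 hd] := path_edist_small a01 e8.
exists d => // b /andP[sb bt] /hd.
have b01 : 0 <= b <= 1 by apply/andP; split; lra.
by move=> /(_ b01) h; split => ?; apply: step; rewrite // edistC.
Qed.

(** Polygons on the three subintervals are joined, and then e tends to 0. Two intermediate points
    are allowed so that the distance from the start can later be shown monotone along a shortest
    path. *)
Lemma path_length_ge s t : 0 <= s -> s <= t -> t <= 1 ->
  ((bdist (g 0) (g s) + bdist (g s) (g t) + bdist (g t) (g 1))%:E
    <= curve_length g)%E.
Proof.
move=> s0 st t1; set X := (X in (X%:E <= _)%E).
have X0 : 0 <= X by rewrite !addr_ge0// bdist_ge0.
have h e : 0 < e <= 1 -> (((1 - e) * X)%:E <= curve_length g)%E.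
  move=> e01.
  have [|||l1 [p1 h1]] := @path_polygon e 0 s e01; [by []|by []|lra|].
  have [l2 [p2 h2]] := path_polygon e01 s0 st t1.
  have [|||l3 [p3 h3]] := @path_polygon e t 1 e01; [lra|by []|by []|].
  have p12 := itv_partition_cat p1 p2.
  apply: le_trans (polygon_length_le_curve _ (itv_partition_cat p12 p3)).
  have [_ /eqP l12] := p12; have [_ /eqP l1s] := p1.
  rewrite lee_fin !polygon_length_cat l12 l1s /X !mulrDr.
  exact: lerD (lerD h1 h2) h3.
case: (curve_length g) h => [r h| |]; last 2 first.
- by rewrite leey.
- by move=> /(_ 1); rewrite ltr01 lexx => /(_ isT).
rewrite lee_fin; apply/ler_addgt0Pr => e e0.
have X1 : 0 < X + e by lra.
have := h (e / (X + e)); rewrite divr_gt0//= ler_pdivrMr// lee_fin.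
(* The loss factor e / (X + e) costs at most e, and its denominator is positive even if X = 0. *)
have ee : e / (X + e) * X <= e.
  by rewrite mulrAC ler_pdivrMr// mulrC; nra.
by rewrite mul1r mulrBl mul1r => /(_ _) h'; have := h' ltac:(lra); lra.
Qed.

Lemma path_bdist_continuous p : bdF0 p ->
  {within `[0, 1], continuous (fun t => bdist p (g t))}.
Proof.
move=> hp; apply/subspace_continuousP => t; rewrite /= in_itv/= => t01.
apply/cvgrPdist_le => e e0.
(* The bound 4 is 8 times 1/2, which gives [bdist] <= 2 [edist]; the bound e^2 / 4 gives [edist] <=
   e / 2. *)
pose d := Num.min 4 (e ^+ 2 / 4).
have d0 : 0 < d by rewrite lt_min ltr0n/= divr_gt0// exprn_gt0.
have [r r0 hr] := path_edist_small t01 d0.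
rewrite near_withinE; apply/nbhs_ballP; exists r => //= s ts; rewrite in_itv/=.
move=> s01; have := hr s s01 ts; rewrite le_min => /andP[h4 he].
have gt_ := gS' t01; have gs_ := gS' s01.
have h1 : bdist (g t) (g s) <= e.
  have h : (1 - 2^-1) * bdist (g t) (g s) <= edist (g t) (g s).
    by apply: bdist_le_edist => //; lra.
  have : edist (g t) (g s) <= e / 2.
    rewrite -ler_sqr ?nnegrE ?edist_ge0//; last lra.
    by rewrite (le_trans he)// exprMn; lra.
  lra.
have bC : bdist (g s) (g t) = bdist (g t) (g s).
  by rewrite /bdist enormBC /angle dotC (mulrC (enorm _)).
have := bdist_triangle hp gt_ gs_; have := bdist_triangle hp gs_ gt_.
rewrite bC => hst hts; rewrite /from_subspace ler_distlC.
apply/andP; split; last by apply: le_trans hts _; rewrite lerD2l.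
by rewrite lerBlDr; apply: le_trans hst _; rewrite lerD2l.
Qed.

End Path.
End Lengths.

(** * Minimality and uniqueness of [sigma] *)

Section Geodesics.
Context {R : realType} {n : nat}.
Variables (u v x y : 'rV[R]_n) (alpha : R).
Hypotheses (hu : enorm u = 1) (hv : enorm v = 1).
Hypotheses (halpha : alpha = angle u v) (alpha_lt : 0 <= alpha < pi).

Let L := Num.sqrt (2 * (enorm (x - y) ^+ 2 + alpha ^+ 2)).
Let p := (x - u, x + u).
Let q := (y - v, y + v).

Let uv : dot u v = cos alpha.
Proof. by rewrite halpha cos_angle. Qed.

Let hp : bdF0 p.
Proof. by exists x, u. Qed.

Let hq : bdF0 q.
Proof. by exists y, v. Qed.

Let bdist_pq : bdist p q = L.
Proof. by rewrite /bdist !center_pair !direction_pair -halpha. Qed.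

Lemma path_in_sigma : path_in (@bdF0 R n) p q (sigma x y u v alpha).
Proof.
split.
- by apply: continuous_subspaceT => t; exact: continuous_sigma.
- by move=> t _; exact: sigma_bdF0.
- exact: sigma0.
- exact: sigma1.
Qed.

Lemma path_in_length g : path_in (@bdF0 R n) p q g -> (L%:E <= curve_length g)%E.
Proof.
(* The chain 0, 0, 0, 1 leaves only the distance from [p] to [q]. *)
case=> gc gS g0 g1; have := @path_length_ge R n g gc gS 0 0.
by rewrite g0 g1 bdistxx// !add0r bdist_pq lexx ler01; exact.
Qed.

Lemma curve_length_sigma : curve_length (sigma x y u v alpha) = L%:E.
Proof.
apply/le_anti/andP; split; last exact: path_in_length path_in_sigma.
apply: ge_ereal_sup => _ [s s01 <-]; rewrite polygon_lengthE lee_fin.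
rewrite -[leRHS]mul1r -[1 in leRHS]subr0; apply: polygon_length_le s01.
by move=> a b ab; exact: edist_sigma.
Qed.

(** The path [g] keeps its parameter, while [sigma] is run at the fraction of L that [g] has
    covered, measured from [p]. *)
Lemma geodesic_same_curve g : path_in (@bdF0 R n) p q g ->
  (curve_length g <= L%:E)%E -> same_curve g (sigma x y u v alpha).
Proof.
move=> [gc gS g0 g1] gL.
have hg t : t \in `[0, 1] -> bdF0 (g t) by exact: gS.
have le3 s t : 0 <= s -> s <= t -> t <= 1 ->
    bdist p (g s) + bdist (g s) (g t) + bdist (g t) q <= L.
  move=> s0 st t1; rewrite -lee_fin; apply: le_trans gL.
  by rewrite -g0 -g1; exact: path_length_ge.
have le2 t : t \in `[0, 1] -> bdist p (g t) + bdist (g t) q <= L.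
  move=> t01; have := le3 t t; have := hg t t01 => /bdistxx ->.
  by move: t01; rewrite in_itv/= addr0 => /andP[? ?]; apply.
have id_change : param_change (@id R).
  by split => //; apply: continuous_subspaceT => ?; exact: cvg_id.
(* If L = 0 this fraction is undefined, but then [g] and [sigma] both stay at [p]. *)
have [L0|L0] := eqVneq L 0.
  exists id, id; split => // t t01; rewrite /=.
  have ht := le2 t t01; have t0 := bdist_ge0 p (g t).
  have t1 := bdist_ge0 (g t) q.
  have <- : p = g t by apply: bdist_eq0 => //; [exact: hg|lra].
  apply: bdist_eq0 => //; first exact: sigma_bdF0.
  have := @path_length_ge R n (sigma x y u v alpha).
  have [sc sS s0 s1] := path_in_sigma.
  move=> /(_ sc sS 0 t); rewrite s0 s1 curve_length_sigma lee_fin L0.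
  move: t01; rewrite in_itv/= => /andP[t0' t1'] /(_ (lexx _) t0' t1').
  rewrite bdistxx// add0r.
  have := bdist_ge0 p (sigma x y u v alpha t).
  have := bdist_ge0 (sigma x y u v alpha t) q.
  move: (bdist p _) (bdist _ q) => a b; lra.
have Lp : 0 < L by rewrite lt_neqAle eq_sym L0 sqrtr_ge0.
exists id, (fun t => bdist p (g t) / L); split => //.
- split.
  + have c := path_bdist_continuous gc gS hp.
    apply: (@within_continuous_comp _ _ _ _ (fun t => bdist p (g t))
      (fun r => r / L)) => //.
    by move=> r _; apply: cvgM; [exact: cvg_id|exact: cvg_cst].
  (* Monotonicity: comparing [le3] with L <= d(p, g t) + d(g t, q) leaves d(p, g s) + d(g s, g t) <=
     d(p, g t). *)
  + move=> s t; rewrite !in_itv/= => /andP[s0 s1] /andP[t0 t1] st.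
    rewrite ler_pM2r ?invr_gt0//.
    have := le3 s t s0 st t1; have := bdist_ge0 (g s) (g t).
    have : L <= bdist p (g t) + bdist (g t) q.
      rewrite -bdist_pq; apply: bdist_triangle => //.
      by apply: hg; rewrite in_itv/= t0.
    move: (bdist (g s) (g t)) (bdist (g t) q) => a b.
    move: (bdist p (g s)) (bdist p (g t)) => c d; lra.
  + by rewrite g0 bdistxx// mul0r.
  + by rewrite g1 bdist_pq divff.
- move=> t t01; rewrite [LHS](@bdist_triangle_eq _ _ p (g t) q)//.
  + by rewrite !center_pair !direction_pair -halpha bdist_pq.
  + exact: hg.
  + by rewrite bdist_pq.
  + by rewrite bdist_pq; exact: le2.
  + by rewrite !direction_pair -halpha; case/andP: alpha_lt.
Qed.

End Geodesics.

Unset Implicit Arguments.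
Set Strict Implicit.

Theorem proposition1p4 (R : realType) (n : nat) (u v : 'rV[R]_n)
    (hu : enorm u = 1) (hv : enorm v = 1)
    (alpha : R) (halpha : alpha = angle u v) (halpha_lt : 0 <= alpha < pi)
    (x y : 'rV[R]_n) :
  [/\ is_geodesic (@bdF0 R n) (x - u, x + u) (y - v, y + v)
        (sigma x y u v alpha),
      forall g : R -> 'rV[R]_n * 'rV[R]_n,
        is_geodesic (@bdF0 R n) (x - u, x + u) (y - v, y + v) g ->
        same_curve g (sigma x y u v alpha)
    & curve_length (sigma x y u v alpha) =
        (Num.sqrt (2 * (enorm (x - y) ^+ 2 + alpha ^+ 2)))%:E].
Proof.
have len := curve_length_sigma x y hu hv halpha halpha_lt.
split=> //.
- split; first exact: path_in_sigma.
  by move=> h ph; rewrite len; exact: (path_in_length hu halpha ph).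
- move=> g [pg gmin]; apply: geodesic_same_curve => //.
  by rewrite -len; apply: gmin; exact: path_in_sigma.
Qed.
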